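(* Let $\mathfrak X=\mathfrak X_I\sqcup\mathfrak X_{II}$ be a finite or countably infinite subset of $\mathbb R$ without limit points, with $\mathfrak X_{II}$ finite, $|\mathfrak X_{II}|=N$. Let $h_I\ge0$ be a function on $\mathfrak X_I$ with $\sum_{x\in\mathfrak X_I}\frac{h_I^2(x)}{1+x^2}<\infty$ and let $h_{II}>0$ be a strictly positive function on $\mathfrak X_{II}$. Define the weight function on $\mathfrak X$ $$f(x)=\begin{cases}\dfrac{h_I^2(x)}{\prod_{y\in\mathfrak X_{II}}(x-y)^2},&x\in\mathfrak X_I,\\[2mm]\dfrac1{h_{II}^2(x)\prod_{y\in\mathfrak X_{II},\,y\ne x}(x-y)^2},&x\in\mathfrak X_{II},\end{cases}$$ and the operator on $\ell^2(\mathfrak X)=\ell^2(\mathfrak X_I)\oplus\ell^2(\mathfrak X_{II})$ $$L=\begin{bmatrix}0&A\\-A^*&0\end{bmatrix},\qquad A(x,y)=\frac{h_I(x)h_{II}(y)}{x-y},\quad x\in\mathfrak X_I,\ y\in\mathfrak X_{II}.$$ Let $K=L(1+L)^{-1}$, let $K^{\rm CD}$ be the $N$th normalized Christoffel--Darboux kernel for the weight $f$, and let $$\varepsilon(x)=\begin{cases}\operatorname{sgn}\Big(\prod_{y\in\mathfrak X_{II}}(x-y)\Big),&x\in\mathfrak X_I,\\ \operatorname{sgn}\Big(\prod_{y\in\mathfrak X_{II}\setminus\{x\}}(x-y)\Big),&x\in\mathfrak X_{II}.\end{cases}$$ Then for all $x,y\in\mathfrak X$ $$K(x,y)=\varepsilon(x)\,(K^{\rm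 CD})^\triangle(x,y)\,\varepsilon(y),$$ where $(K^{\rm CD})^\triangle(x,y)=K^{\rm CD}(x,y)$ if $x\in\mathfrak X_I$ and $(K^{\rm CD})^\triangle(x,y)=\delta_{xy}-K^{\rm CD}(x,y)$ if $x\in\mathfrak X_{II}$.
   Context: The weight $f$ is nonnegative, strictly positive on the $N$-point set $\mathfrak X_{II}$, and $\sum_{x\in\mathfrak X}x^{2N-2}f(x)<\infty$. Let $p_0=1,p_1,\dots,p_{N-1}$ be the monic polynomials obtained by orthogonalizing $1,x,\dots,x^{N-1}$ in $L^2(\mathfrak X,f\mu)$, $\mu$ being counting measure, and $h_n=\sum_{x\in\mathfrak X}p_n^2(x)f(x)$. The $N$th normalized Christoffel--Darboux kernel is $$K^{\rm CD}(x,y)=\sqrt{f(x)f(y)}\sum_{n=0}^{N-1}\frac{p_n(x)p_n(y)}{h_n},\qquad x,y\in\mathfrak X.$$ Operators on $\ell^2(\mathfrak X)$ are identified with their matrices; $A$ is viewed as an operator from $\ell^2(\mathfrak X_{II})$ to $\ell^2(\mathfrak X_I)$. *)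

(* Defs.v *)
From HB Require Import structures.
From mathcomp Require Import all_boot all_order all_algebra finmap complex.
From mathcomp Require Import all_classical all_reals all_analysis.

Set Implicit Arguments.
Unset Strict Implicit.
Unset Printing Implicit Defensive.

Import Order.TTheory GRing.Theory Num.Theory.
Import numFieldNormedType.Exports.
Local Open Scope classical_set_scope.
Local Open Scope fset_scope.
Local Open Scope ring_scope.
Local Open Scope complex_scope.

Section HilbertSpace.
Variables (R : realType) (T : choiceType).
Implicit Types (u v : T -> R[i]) (B S : (T -> R[i]) -> (T -> R[i])).

Definition sqnorm u : \bar R :=
  \esum_(x in [set: T]) (Normc.normc (u x) ^+ 2)%:E.

Definition ell2 : set (T -> R[i]) := [set u | (sqnorm u < +oo)%E].

(* An operator on l^2(T) is represented by a map on all functions T -> R[i],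
   of which only the restriction to ell2 is meaningful. *)
Definition bounded_operator B : Prop :=
  (forall (a : R[i]) u v, ell2 u -> ell2 v ->
     B (fun x => a * u x + v x) = (fun x => a * B u x + B v x)) /\
  (exists M : R, forall u, ell2 u ->
     (sqnorm (B u) <= (M ^+ 2)%:E * sqnorm u)%E).

Definition basis_vector (y : T) : T -> R[i] := fun x => (x == y)%:R.

Definition kernel_of B (x y : T) : R[i] := B (basis_vector y) x.

Definition one_plus B : (T -> R[i]) -> (T -> R[i]) := fun u x => u x + B u x.

Definition bounded_inverse B S : Prop :=
  bounded_operator S /\ (forall u, ell2 u -> B (S u) = u /\ S (B u) = u).

End HilbertSpace.

Section OrthogonalPolynomials.
Variables (R : realType) (X : set R) (w : R -> R).
Implicit Types (p q : {poly R}) (F : R -> R).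

(* Meaningful for absolutely convergent families. This is the case in wdot p q
   for size p, size q <= N and the weight below: under the summability
   assumption on hI, x ^+ (2 * N - 2) * weight x is summable over X. *)
Definition sum_over F : R :=
  fine (\esum_(x in X) (Num.max (F x) 0)%:E) -
  fine (\esum_(x in X) (Num.max (- F x) 0)%:E).

Definition wdot p q : R := sum_over (fun x => p.[x] * q.[x] * w x).

(* Gram-Schmidt without normalization, applied to 'X^0, ..., 'X^n.-1 *)
Fixpoint gram_schmidt (n : nat) : seq {poly R} :=
  if n is m.+1 then
    let s := gram_schmidt m in
    rcons s ('X^m - \sum_(q <- s) (wdot 'X^m q / wdot q q) *: q)
  else [::].

Definition orth_poly (n : nat) : {poly R} := (gram_schmidt n.+1)`_n.

Definition CD_kernel (N : nat) (x y : R) : R :=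
  Num.sqrt (w x * w y) *
  \sum_(n < N) (orth_poly n).[x] * (orth_poly n).[y]
               / wdot (orth_poly n) (orth_poly n).

End OrthogonalPolynomials.

(* The functions below are used on X = XI `|` [set` XII] with XI and XII
   disjoint, so that x \notin XII means x \in XI. *)
Section Kernels.
Variables (R : realType) (XII : {fset R}) (hI hII : R -> R).
Implicit Types (x y : R).

Definition weight x : R :=
  if x \in XII
  then (hII x ^+ 2 * \prod_(y <- XII | y != x) (x - y) ^+ 2)^-1
  else hI x ^+ 2 / \prod_(y <- XII) (x - y) ^+ 2.

Definition A_kernel x y : R := hI x * hII y / (x - y).

(* The matrix [0, A; -A^*, 0]; A has real entries, so that A^* is its
   transpose. *)
Definition L_kernel x y : R :=
  match x \in XII, y \in XII with
  | false, true => A_kernel x y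
  | true, false => - A_kernel y x
  | _, _ => 0
  end.

Definition eps x : R :=
  if x \in XII then Num.sg (\prod_(y <- XII | y != x) (x - y))
  else Num.sg (\prod_(y <- XII) (x - y)).

Definition particle_hole (K : R -> R -> R) x y : R :=
  if x \in XII then (x == y)%:R - K x y else K x y.

End Kernels.

(* Main.v *)
(** Multiplication by [eps * sqrt f] turns the polynomials of degree less than
    [N] into a subspace [V] of [l^2(X)] which, by Lagrange interpolation at the
    points of [X_II], is exactly the graph [{A v + v}] of [A]; hence the
    orthogonal complement of [V] is [{u - A^* u}].  Conjugating the
    Christoffel-Darboux kernel by [eps] gives the orthogonal projection [Q] on
    [V].  If [v = q + r] with [q = Q v], then [1 + L] maps the vector equal to
    [r] on [X_I] and to [q] on [X_II] to
    [(r_I - A^* r_I) + (A q_II + q_II) = r + q = v], which gives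
    [S = (1 + L)^-1], and [K = 1 - S].  Uniqueness of a bounded operator with
    given matrix reduces an arbitrary [L] to the explicit finite rank one, and
    antisymmetry of [L] makes [1 + L] injective. *)

Require Import Defs.
From mathcomp Require Import all_boot all_order all_algebra finmap complex.
From mathcomp Require Import all_classical all_reals all_analysis.
From mathcomp Require Import ring lra.

Set Implicit Arguments.
Unset Strict Implicit.
Unset Printing Implicit Defensive.

Import Order.TTheory GRing.Theory Num.Theory.
Import numFieldNormedType.Exports.
Local Open Scope classical_set_scope.
Local Open Scope fset_scope.
Local Open Scope ring_scope.
Local Open Scope complex_scope.

(** * Unordered sums of reals *)

Section RealSums.
Variables (R : realType) (T : choiceType).
Implicit Types (F G H : T -> R) (c : R).

Definition nnsum F : \bar R := \esum_(x in [set: T]) (F x)%:E.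

Definition abs_summable F : Prop := (nnsum (fun x => `|F x|%R) < +oo)%E.

(** The same positive-minus-negative shape as [sum_over], but over a whole type. Since [fine] sends
    infinity to 0, it is meaningful under [abs_summable]. *)
Definition rsum F : R :=
  fine (nnsum (fun x => Num.max (F x) 0)) -
  fine (nnsum (fun x => Num.max (- F x) 0)).

Lemma nnsum_ge0 F : (forall x, 0 <= F x) -> (0 <= nnsum F)%E.
Proof. by move=> F0; apply: esum_ge0 => x _; rewrite lee_fin. Qed.

Lemma le_nnsum F G : (forall x, F x <= G x) -> (nnsum F <= nnsum G)%E.
Proof. by move=> FG; apply: le_esum => x _; rewrite lee_fin. Qed.

Lemma eq_nnsum F G : F =1 G -> nnsum F = nnsum G.
Proof. by move=> FG; apply: eq_esum => x _; rewrite FG. Qed.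

Lemma nnsumD F G : (forall x, 0 <= F x) -> (forall x, 0 <= G x) ->
  nnsum (fun x => F x + G x) = (nnsum F + nnsum G)%E.
Proof.
by move=> F0 G0; rewrite /nnsum -esumD => [|x _|x _]; rewrite ?lee_fin.
Qed.

Lemma nnsum_pt F x : (forall y, 0 <= F y) -> ((F x)%:E <= nnsum F)%E.
Proof.
move=> F0; apply: esum_ge; exists [set x]; last by rewrite fsbig_set1.
by split => //; exact: finite_set1.
Qed.

Lemma nnsum_single F a : (forall x, 0 <= F x) -> (forall x, x != a -> F x = 0) ->
  nnsum F = (F a)%:E.
Proof.
move=> F0 Fa.
have -> : (F a)%:E = \esum_(x in [set a]) (F x)%:E.
  by rewrite esum_set1 ?lee_fin.
rewrite [RHS]esum_mkcond; apply: eq_esum => x _.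
case: ifPn => //; rewrite notin_setE => xa; rewrite Fa//.
by apply/eqP => ?; apply: xa.
Qed.

Lemma abs_summable_fin_num F G :
  (forall x, 0 <= G x <= `|F x|) -> abs_summable F -> nnsum G \is a fin_num.
Proof.
move=> GF sF; rewrite ge0_fin_numE; last first.
  by apply: nnsum_ge0 => x; case/andP: (GF x).
by apply: le_lt_trans sF; apply: le_nnsum => x; case/andP: (GF x).
Qed.

(** With F+ and F- the two parts of F, F+ + H = G + F- holds pointwise and all four sums are finite,
    since F+ <= G and F- <= H. Linearity of [rsum] follows by choosing G and H suitably. *)
Lemma rsum_sub F G H : (forall x, 0 <= G x) -> (forall x, 0 <= H x) ->
  nnsum G \is a fin_num -> nnsum H \is a fin_num ->
  (forall x, F x = G x - H x) -> rsum F = fine (nnsum G) - fine (nnsum H).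
Proof.
move=> G0 H0 fG fH FE; rewrite /rsum.
have p0 x : 0 <= Num.max (F x) 0 by rewrite le_max lexx orbT.
have m0 x : 0 <= Num.max (- F x) 0 by rewrite le_max lexx orbT.
have pf : nnsum (fun x => Num.max (F x) 0) \is a fin_num.
  rewrite ge0_fin_numE ?nnsum_ge0//; move: fG; rewrite ge0_fin_numE ?nnsum_ge0//.
  apply: le_lt_trans; apply: le_nnsum => x.
  by rewrite ge_max G0 FE lerBlDr lerDl H0.
have mf : nnsum (fun x => Num.max (- F x) 0) \is a fin_num.
  rewrite ge0_fin_numE ?nnsum_ge0//; move: fH; rewrite ge0_fin_numE ?nnsum_ge0//.
  apply: le_lt_trans; apply: le_nnsum => x.
  by rewrite ge_max H0 FE opprB lerBlDr lerDl G0.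
have : (nnsum (fun x => Num.max (F x) 0)%R + nnsum H =
        nnsum G + nnsum (fun x => Num.max (- F x) 0)%R)%E.
  rewrite -!nnsumD//; apply: eq_nnsum => x; rewrite FE.
  by rewrite /Num.max; case: ifP; case: ifP; lra.
move/(congr1 fine); rewrite !fineD//; lra.
Qed.

Lemma eq_abs_summable F G : F =1 G -> abs_summable F -> abs_summable G.
Proof. by move=> /funext ->. Qed.

Lemma eq_rsum F G : F =1 G -> rsum F = rsum G.
Proof. by move=> /funext ->. Qed.

Lemma le_abs_summable F G :
  (forall x, `|G x| <= `|F x|) -> abs_summable F -> abs_summable G.
Proof. by move=> GF; apply: le_lt_trans; apply: le_nnsum. Qed.

Lemma abs_summableD F G : abs_summable F -> abs_summable G ->
  abs_summable (fun x => F x + G x).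
Proof.
move=> sF sG; apply: (@le_lt_trans _ _ (nnsum (fun x => `|F x| + `|G x|))).
  by apply: le_nnsum => x; exact: ler_normD.
by rewrite nnsumD//; exact: lte_add_pinfty.
Qed.

Lemma nnsumZ c F : 0 <= c -> (forall x, 0 <= F x) -> 
  nnsum (fun x => c * F x) = (c%:E * nnsum F)%E.
Proof.
move=> c0 F0; have le_nnsumZ (k : R) (G : T -> R) : 0 <= k ->
    (forall x, 0 <= G x) -> (nnsum (fun x => (k * G x)%R) <= k%:E * nnsum G)%E.
  move=> k0 G0; apply: ge_ereal_sup => _ [A [finA AT] <-].
  under eq_fsbigr do rewrite EFinM.
  rewrite -ge0_mule_fsumr; last by move=> x; rewrite lee_fin.
  by apply: lee_wpmul2l; rewrite ?lee_fin//; apply: esum_ge; exists A.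
apply/eqP; rewrite eq_le le_nnsumZ//=.
have := c0; rewrite [0 <= c]le_eqVlt => /predU1P[<-|{}c0].
  by rewrite mul0e nnsum_ge0// => x; rewrite mul0r.
(* The reverse inequality is the one just proved, for the factor c^-1 and the function c F. *)
rewrite -lee_pdivlMl//; apply: le_trans (le_nnsumZ _ _ _ _).
- by apply: le_nnsum => x; rewrite mulKf// gt_eqF.
- by rewrite invr_ge0 ltW.
- by move=> x; rewrite mulr_ge0// ltW.
Qed.

Lemma abs_summableZ c F : abs_summable F -> abs_summable (fun x => c * F x).
Proof.
rewrite /abs_summable => sF; under eq_fun do rewrite normrM.
rewrite nnsumZ//; apply: lte_mul_pinfty => //; rewrite ?lee_fin//.
Qed.

Lemma abs_summable0 : abs_summable (fun=> 0).
Proof.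
by rewrite /abs_summable /nnsum esum1// => x _; rewrite normr0.
Qed.

Let maxrB c : Num.max c 0 - Num.max (- c) 0 = c.
Proof. by rewrite /Num.max; case: ifPn; case: ifPn; lra. Qed.

Let rsumE F : abs_summable F ->
  [/\ nnsum (fun x => Num.max (F x) 0) \is a fin_num,
      nnsum (fun x => Num.max (- F x) 0) \is a fin_num,
      forall x, 0 <= Num.max (F x) 0 & forall x, 0 <= Num.max (- F x) 0].
Proof.
move=> sF; split.
- apply: abs_summable_fin_num sF => x.
  by rewrite le_max lexx orbT ge_max ler_norm normr_ge0.
- apply: abs_summable_fin_num sF => x.
  by rewrite le_max lexx orbT ge_max normr_ge0 -normrN ler_norm.
- by move=> x; rewrite le_max lexx orbT.
- by move=> x; rewrite le_max lexx orbT.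
Qed.

Lemma rsumD F G : abs_summable F -> abs_summable G ->
  rsum (fun x => F x + G x) = rsum F + rsum G.
Proof.
move=> /rsumE[F1 F2 F3 F4] /rsumE[G1 G2 G3 G4].
rewrite (@rsum_sub _ (fun x => Num.max (F x) 0 + Num.max (G x) 0)
   (fun x => Num.max (- F x) 0 + Num.max (- G x) 0)).
- by rewrite !nnsumD// !fineD// /rsum; lra.
- by move=> x; rewrite addr_ge0.
- by move=> x; rewrite addr_ge0.
- by rewrite nnsumD// fin_numD F1.
- by rewrite nnsumD// fin_numD F2.
- by move=> x; rewrite -[in LHS](maxrB (F x)) -[in LHS](maxrB (G x)); lra.
Qed.

Lemma ge0_rsum F : (forall x, 0 <= F x) -> abs_summable F ->
  (rsum F)%:E = nnsum F.
Proof.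
move=> F0 sF; have fF : nnsum F \is a fin_num.
  by apply: abs_summable_fin_num sF => x; rewrite F0 ler_norm.
have nn0 : nnsum (fun=> 0) = 0%E by rewrite /nnsum esum1.
rewrite (@rsum_sub _ F (fun=> 0))// ?nn0//= ?subr0 ?fineK// => x.
by rewrite subr0.
Qed.

Lemma rsumZ c F : abs_summable F -> rsum (fun x => c * F x) = c * rsum F.
Proof.
move=> /rsumE[F1 F2 F3 F4]; have [c0|/ltW c0] := leP 0 c.
  rewrite (@rsum_sub _ (fun x => c * Num.max (F x) 0)
     (fun x => c * Num.max (- F x) 0)).
  - by rewrite !nnsumZ// !fineM// /rsum mulrBr.
  - by move=> x; rewrite mulr_ge0.
  - by move=> x; rewrite mulr_ge0.
  - by rewrite nnsumZ// fin_numM.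
  - by rewrite nnsumZ// fin_numM.
  - by move=> x; rewrite -mulrBr maxrB.
(* A nonpositive factor exchanges the positive and negative parts. *)
rewrite (@rsum_sub _ (fun x => - c * Num.max (- F x) 0)
     (fun x => - c * Num.max (F x) 0)).
- by rewrite !nnsumZ// ?oppr_ge0// !fineM// /rsum /=; ring.
- by move=> x; rewrite mulr_ge0// oppr_ge0.
- by move=> x; rewrite mulr_ge0// oppr_ge0.
- by rewrite nnsumZ ?oppr_ge0// fin_numM.
- by rewrite nnsumZ ?oppr_ge0// fin_numM.
- by move=> x; rewrite mulNr mulNr opprK addrC -mulrBr maxrB.
Qed.

Lemma abs_summable_single F a : (forall x, x != a -> F x = 0) -> abs_summable F.
Proof.
move=> Fa; rewrite /abs_summable (@nnsum_single _ a) ?ltry// => x xa.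
by rewrite Fa ?normr0.
Qed.

Lemma rsum_single F a : (forall x, x != a -> F x = 0) -> rsum F = F a.
Proof.
move=> Fa; rewrite /rsum !(@nnsum_single _ a)/=.
- exact: maxrB.
- by move=> x; rewrite le_max lexx orbT.
- by move=> x xa; rewrite Fa// oppr0 maxxx.
- by move=> x; rewrite le_max lexx orbT.
- by move=> x xa; rewrite Fa// maxxx.
Qed.

End RealSums.

(** * Real square-summable functions *)

Section RealHilbert.
Variables (R : realType) (T : choiceType).
Implicit Types (u v k g s : T -> R) (c : R) (B : (T -> R) -> T -> R).

Definition l2 u : Prop := abs_summable (fun x => u x ^+ 2).

Definition dot u v : R := rsum (fun x => u x * v x).

Lemma l2_mul u v : l2 u -> l2 v -> abs_summable (fun x => u x * v x).
Proof.
move=> lu lv; apply: le_abs_summable (abs_summableD lu lv) => x.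
rewrite (le_trans _ (ler_norm _))// ler_norml.
by apply/andP; split; nra.
Qed.

(** Pointwise (c u + v)^2 <= 2 c^2 u^2 + 2 v^2. *)
Lemma l2D c u v : l2 u -> l2 v -> l2 (fun x => c * u x + v x).
Proof.
move=> lu lv; apply: le_abs_summable (abs_summableD
  (abs_summableZ (2 * c ^+ 2) lu) (abs_summableZ 2 lv)) => x.
rewrite ger0_norm ?sqr_ge0// (le_trans _ (ler_norm _))//.
by have := sqr_ge0 (c * u x - v x); nra.
Qed.

Lemma l2_0 : l2 (fun=> 0).
Proof. by apply: eq_abs_summable (@abs_summable0 R T) => x; rewrite expr0n. Qed.

Lemma l2Z c u : l2 u -> l2 (fun x => c * u x).
Proof.
by move=> lu; apply: eq_abs_summable (l2D c lu l2_0) => x; rewrite addr0.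
Qed.

Lemma l2_sum (I : eqType) (r : seq I) (a : I -> R) (u : I -> T -> R) :
  (forall i, i \in r -> l2 (u i)) -> l2 (fun x => \sum_(i <- r) a i * u i x).
Proof.
elim: r => [_|i r IH lu]; first by under eq_fun do rewrite big_nil; exact: l2_0.
under eq_fun do rewrite big_cons.
apply: l2D; first by apply: lu; rewrite mem_head.
by apply: IH => j jr; apply: lu; rewrite in_cons jr orbT.
Qed.

Lemma l2_single u a : (forall x, x != a -> u x = 0) -> l2 u.
Proof.
by move=> ua; apply: (@abs_summable_single _ _ _ a) => x /ua ->; rewrite expr0n.
Qed.

Lemma l2_mask s u : (forall x, `|s x| <= 1) -> l2 u -> l2 (fun x => s x * u x).
Proof.
move=> s1; apply: le_abs_summable => x.
by rewrite exprMn normrM ler_piMl// normrX exprn_ile1.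
Qed.

Lemma dotC u v : dot u v = dot v u.
Proof. by apply: eq_rsum => x; rewrite mulrC. Qed.

Lemma dotZr k c u : l2 k -> l2 u -> dot k (fun x => c * u x) = c * dot k u.
Proof.
by move=> lk lu; rewrite -rsumZ; [apply: eq_rsum => x; ring|exact: l2_mul].
Qed.

Lemma dotDr k c u v : l2 k -> l2 u -> l2 v ->
  dot k (fun x => c * u x + v x) = c * dot k u + dot k v.
Proof.
move=> lk lu lv; rewrite -rsumZ -?rsumD; first by apply: eq_rsum => x; ring.
- exact/abs_summableZ/l2_mul.
- exact: l2_mul.
- exact: l2_mul.
Qed.

Lemma dot_sumr k (I : eqType) (r : seq I) (a : I -> R) (u : I -> T -> R) :
  l2 k -> (forall i, i \in r -> l2 (u i)) ->
  dot k (fun x => \sum_(i <- r) a i * u i x) = \sum_(i <- r) a i * dot k (u i).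
Proof.
move=> lk; elim: r => [_|i r IH lu].
  rewrite big_nil (_ : (fun x => _) = (fun x => 0 * k x)) ?dotZr ?mul0r//.
  by apply/funext => x; rewrite big_nil mul0r.
have lr j : j \in r -> l2 (u j) by move=> jr; apply: lu; rewrite in_cons jr orbT.
under eq_fun do rewrite big_cons.
by rewrite big_cons dotDr ?IH//; [apply: lu; rewrite mem_head|exact: l2_sum].
Qed.

Lemma dot_single u v a : (forall x, x != a -> u x = 0) -> dot u v = u a * v a.
Proof. by move=> ua; apply: rsum_single => x /ua ->; rewrite mul0r. Qed.

Lemma dotEn u : l2 u -> (dot u u)%:E = nnsum (fun x => u x ^+ 2).
Proof. by move=> lu; rewrite -ge0_rsum// => x; exact: sqr_ge0. Qed.

Lemma dot_pt u x : l2 u -> u x ^+ 2 <= dot u u.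
Proof.
move=> lu; rewrite -lee_fin dotEn//.
by apply: (@nnsum_pt _ _ (fun x => u x ^+ 2)) => y; exact: sqr_ge0.
Qed.

Lemma dot_ge0 u : l2 u -> 0 <= dot u u.
Proof. by move=> lu; rewrite -lee_fin dotEn// nnsum_ge0// => x; exact: sqr_ge0. Qed.

Lemma le_dot u v : l2 v -> (forall x, u x ^+ 2 <= v x ^+ 2) -> dot u u <= dot v v.
Proof.
move=> lv uv; have lu : l2 u.
  by apply: le_abs_summable lv => x; rewrite !ger0_norm ?sqr_ge0.
by rewrite -lee_fin !dotEn//; exact: le_nnsum.
Qed.

Lemma dotDD c u v : l2 u -> l2 v ->
  dot (fun x => c * u x + v x) (fun x => c * u x + v x) =
  c ^+ 2 * dot u u + c * dot u v *+ 2 + dot v v.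
Proof.
move=> lu lv; have luv := l2D c lu lv.
by rewrite dotDr// ![dot (fun x => _ + _) _]dotC !dotDr// (dotC v u); ring.
Qed.

(** If [dot k k] is 0, then k vanishes pointwise. Otherwise the squared norm of u minus its
    component along k, multiplied by [dot k k], is the difference of the two sides. *)
Lemma Cauchy_Schwarz k u : l2 k -> l2 u -> dot k u ^+ 2 <= dot k k * dot u u.
Proof.
move=> lk lu; have := dot_ge0 lk; rewrite le_eqVlt => /predU1P[kk0|kk0].
  have k0 x : k x = 0.
    by apply/eqP; rewrite -sqrf_eq0 eq_le sqr_ge0 kk0 dot_pt.
  rewrite -kk0 mul0r (_ : dot k u = 0) ?expr0n//.
  rewrite -(mul0r (dot k u)) -rsumZ; last exact: l2_mul.
  by apply: eq_rsum => x; rewrite k0 !mul0r.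
have := dot_ge0 (l2D (- (dot k u / dot k k)) lk lu).
rewrite dotDD// => h.
have : 0 <= dot k k * ((- (dot k u / dot k k)) ^+ 2 * dot k k +
  - (dot k u / dot k k) * dot k u *+ 2 + dot u u) by rewrite mulr_ge0// ltW.
rewrite (_ : _ * _ = dot k k * dot u u - dot k u ^+ 2) ?subr_ge0//.
by field; rewrite gt_eqF.
Qed.

(** * Bounded operators on real l^2 *)

Definition rlinear B : Prop := forall c u v, l2 u -> l2 v ->
  B (fun x => c * u x + v x) = (fun x => c * B u x + B v x).

(** Everything is asked on [l2] only, where [dot] is bilinear. The constant bounds squared norms, so
    no square root enters the closure lemmas below. *)
Definition rbounded B : Prop :=
  [/\ rlinear B, forall u, l2 u -> l2 (B u) &
      exists2 C, 0 <= C & forall u, l2 u -> dot (B u) (B u) <= C * dot u u].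

Lemma rbounded_mask s : (forall x, `|s x| <= 1) -> rbounded (fun u x => s x * u x).
Proof.
move=> s1; split.
- by move=> c u v _ _; apply/funext => x; ring.
- by move=> u; exact: l2_mask.
- exists 1 => // u lu; rewrite mul1r le_dot// => x.
  by rewrite exprMn ler_piMl ?sqr_ge0// -real_normK ?num_real// exprn_ile1.
Qed.

(** The squared norm of the image is [dot k u ^+ 2 * dot g g], to which Cauchy-Schwarz applies. *)
Lemma rbounded_rank1 g k : l2 g -> l2 k -> rbounded (fun u x => dot k u * g x).
Proof.
move=> lg lk; split.
- by move=> c u v lu lv; apply/funext => x; rewrite dotDr//; ring.
- by move=> u _; exact: l2Z.
- exists (dot g g * dot k k) => [|u lu]; first by rewrite mulr_ge0// dot_ge0.
  have -> : dot (fun x => dot k u * g x) (fun x => dot k u * g x) =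
      dot k u ^+ 2 * dot g g.
    by rewrite -rsumZ; [apply: eq_rsum => x; ring|exact: l2_mul].
  by rewrite mulrC -mulrA ler_wpM2l ?dot_ge0// Cauchy_Schwarz.
Qed.

Lemma rboundedD B1 B2 : rbounded B1 -> rbounded B2 ->
  rbounded (fun u x => B1 u x + B2 u x).
Proof.
move=> [lin1 l1 [C1 C10 b1]] [lin2 l2' [C2 C20 b2]].
have l12 u : l2 u -> l2 (fun x => B1 u x + B2 u x).
  move=> lu; apply: eq_abs_summable (l2D 1 (l1 u lu) (l2' u lu)) => x.
  by rewrite mul1r.
split=> //.
- by move=> c u v lu lv; apply/funext => x; rewrite lin1// lin2//; ring.
- exists (2 * (C1 + C2)) => [|u lu]; first by rewrite mulr_ge0 ?addr_ge0.
  have [lu1 lu2] := (l1 u lu, l2' u lu).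
  (* The squared norm of B2 u - B1 u is nonnegative; this bounds the cross term and yields the
     factor 2 in the constant. *)
  have le2 : 2 * dot (B1 u) (B2 u) <= dot (B1 u) (B1 u) + dot (B2 u) (B2 u).
    by have := dot_ge0 (l2D (-1) lu1 lu2); rewrite dotDD//; lra.
  rewrite -[X in dot X _](_ : (fun x => 1 * B1 u x + B2 u x) = _); last first.
    by apply/funext => x; rewrite mul1r.
  rewrite -[X in dot _ X](_ : (fun x => 1 * B1 u x + B2 u x) = _); last first.
    by apply/funext => x; rewrite mul1r.
  rewrite dotDD//; have := b1 u lu; have := b2 u lu; lra.
Qed.

Lemma rbounded_sum (I : eqType) (r : seq I) (B : I -> (T -> R) -> T -> R) :
  (forall i, i \in r -> rbounded (B i)) ->
  rbounded (fun u x => \sum_(i <- r) B i u x).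
Proof.
elim: r => [_|i r IH bB].
  have -> : (fun u x => \sum_(i <- [::]) B i u x) = (fun u x => 0 * u x).
    by apply/funext => u; apply/funext => x; rewrite big_nil mul0r.
  by apply: rbounded_mask => x; rewrite normr0.
have -> : (fun u x => \sum_(i <- i :: r) B i u x) =
    (fun u x => B i u x + \sum_(i <- r) B i u x).
  by apply/funext => u; apply/funext => x; rewrite big_cons.
apply: rboundedD; first by apply: bB; rewrite mem_head.
by apply: IH => j jr; apply: bB; rewrite in_cons jr orbT.
Qed.

End RealHilbert.

(** * Operators on complex l^2 *)

Section ComplexHilbert.
Variables (R : realType) (T : choiceType).
Implicit Types (u v : T -> R[i]) (B : (T -> R) -> T -> R).
Implicit Types (L : (T -> R[i]) -> T -> R[i]).

Definition reF u : T -> R := fun x => complex.Re (u x).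
Definition imF u : T -> R := fun x => complex.Im (u x).

Lemma sqnormE u : sqnorm u =
  (nnsum (fun x => reF u x ^+ 2)%R + nnsum (fun x => imF u x ^+ 2)%R)%E.
Proof.
rewrite -nnsumD; [|by move=> x; exact: sqr_ge0..].
apply: eq_esum => x _; rewrite /reF /imF; case: (u x) => a b /=.
by rewrite sqr_sqrtr// addr_ge0 ?sqr_ge0.
Qed.

Lemma l2E (w : T -> R) : l2 w <-> (nnsum (fun x => w x ^+ 2)%R < +oo)%E.
Proof.
rewrite /l2 /abs_summable (_ : (fun x => `|w x ^+ 2|) = (fun x => w x ^+ 2))//.
by apply/funext => x; rewrite ger0_norm ?sqr_ge0.
Qed.

Lemma ell2P u : ell2 u <-> l2 (reF u) /\ l2 (imF u).
Proof.
rewrite /ell2/= sqnormE !l2E; split=> [|[]]; last exact: lte_add_pinfty.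
have r0 : (0 <= nnsum (fun x => reF u x ^+ 2)%R)%E.
  by apply: nnsum_ge0 => x; exact: sqr_ge0.
have i0 : (0 <= nnsum (fun x => imF u x ^+ 2)%R)%E.
  by apply: nnsum_ge0 => x; exact: sqr_ge0.
by move=> h; split; apply: le_lt_trans h; rewrite ?leeDl ?leeDr.
Qed.

Lemma sqnorm_dot u : ell2 u ->
  sqnorm u = (dot (reF u) (reF u) + dot (imF u) (imF u))%:E.
Proof. by move=> /ell2P[ru iu]; rewrite sqnormE EFinD !dotEn. Qed.

Lemma sqnorm_pt u x : ((Normc.normc (u x) ^+ 2)%:E <= sqnorm u)%E.
Proof.
by apply: (@nnsum_pt _ _ (fun x => Normc.normc (u x) ^+ 2)) => y; exact: sqr_ge0.
Qed.

(** Complexification: a real operator acts separately on real and imaginary parts. *)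
Definition cext B : (T -> R[i]) -> T -> R[i] :=
  fun u x => B (reF u) x +i* B (imF u) x.

Lemma bounded_operator_ell2 L u : bounded_operator L -> ell2 u -> ell2 (L u).
Proof.
move=> [_ [M bM]] lu; apply: le_lt_trans (bM u lu) _.
by rewrite lte_mul_pinfty// ?lee_fin ?sqr_ge0.
Qed.

Lemma reF_lin (a : R[i]) u v : reF (fun x => a * u x + v x) =
  (fun x => complex.Re a * reF u x + (- complex.Im a * imF u x + reF v x)).
Proof.
apply/funext => y; rewrite /reF /imF.
by case: a => ? ?; case: (u y) => ? ?; case: (v y) => ? ? /=; ring.
Qed.

Lemma imF_lin (a : R[i]) u v : imF (fun x => a * u x + v x) =
  (fun x => complex.Re a * imF u x + (complex.Im a * reF u x + imF v x)).
Proof.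
apply/funext => y; rewrite /reF /imF.
by case: a => ? ?; case: (u y) => ? ?; case: (v y) => ? ? /=; ring.
Qed.

Lemma ell2_lin (a : R[i]) u v : ell2 u -> ell2 v -> ell2 (fun x => a * u x + v x).
Proof.
move=> /ell2P[ru iu] /ell2P[rv iv]; apply/ell2P.
by rewrite reF_lin imF_lin; split; do 2 apply: l2D => //.
Qed.

Lemma cext_bounded B : rbounded B -> bounded_operator (cext B).
Proof.
move=> [lin lB [C C0 bB]]; split.
- move=> a u v /ell2P[ru iu] /ell2P[rv iv]; apply/funext => x.
  have lr := l2D (- complex.Im a) iu rv; have li := l2D (complex.Im a) ru iv.
  rewrite /cext reF_lin imF_lin !lin//; case: a {lr li} => a b.
  by apply/eqP; rewrite eq_complex /=; apply/andP; split; apply/eqP; ring.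
(* [bounded_operator] squares its constant, whereas C already bounds squared norms. *)
- exists (Num.sqrt C) => u lu; have /ell2P[ru iu] := lu.
  have lBu : ell2 (cext B u) by apply/ell2P; split; exact: lB.
  rewrite !sqnorm_dot// -EFinM lee_fin sqr_sqrtr// mulrDr.
  by rewrite lerD ?bB.
Qed.

(** * Bounded operators are determined by their matrices *)

Lemma ell2_basis (y : T) : ell2 (basis_vector R y).
Proof.
by apply/ell2P; split; apply: (@l2_single _ _ _ y) => x /negbTE xy;
  rewrite /reF /imF /basis_vector xy.
Qed.

Lemma bounded_operator0 L : bounded_operator L -> L (fun=> 0) = (fun=> 0).
Proof.
move=> [lin _]; have l0 : ell2 (fun _ : T => 0 : R[i]).
  by apply/ell2P; split; exact: l2_0.
have := lin (-1) _ _ l0 l0.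
rewrite (_ : (fun x : T => -1 * 0 + 0) = (fun=> 0)); last first.
  by apply/funext => x; rewrite mulr0 addr0.
by move=> ->; apply/funext => x; rewrite mulN1r addNr.
Qed.

(** Linearity is available on [ell2] only, so the induction on s must carry membership along with
    the equality. *)
Lemma eq_kernel_finite L L' (s : seq T) (c : T -> R[i]) :
  bounded_operator L -> bounded_operator L' ->
  (forall x y, kernel_of L x y = kernel_of L' x y) ->
  let u := fun x => \sum_(y <- s) c y * basis_vector R y x in
  ell2 u /\ L u = L' u.
Proof.
move=> bL bL' LL' /=; elim: s => [|y s [lu IH]].
  rewrite (_ : (fun x => _) = (fun=> 0)); last first.
    by apply/funext => x; rewrite big_nil.
  by rewrite !bounded_operator0//; split=> //; apply/ell2P; split; exact: l2_0.
rewrite (_ : (fun x => _) = (fun x => c y * basis_vector R y x +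
    \sum_(y <- s) c y * basis_vector R y x)); last first.
  by apply/funext => x; rewrite big_cons.
have ly := @ell2_basis y; split; first exact: ell2_lin.
case: bL => -> // _; case: bL' => -> // _; rewrite IH.
by apply/funext => x; congr (_ * _ + _); exact: LL'.
Qed.

(** The squared norm is a supremum of finite partial sums; a finite set whose partial sum comes
    within e of it leaves at most e outside. *)
Lemma ell2_tail u (e : R) : ell2 u -> 0 < e ->
  exists s : seq T, uniq s /\
    (sqnorm (fun x => if x \in s then 0 else u x)%R <= e%:E)%E.
Proof.
move=> lu e0; have fu : sqnorm u \is a fin_num.
  by rewrite ge0_fin_numE// nnsum_ge0// => x; exact: sqr_ge0.
have : (sqnorm u - e%:E < sqnorm u)%E by rewrite lteBlDr// lteDl// lte_fin.
rewrite {2}/sqnorm => /ereal_sup_gt[_ [A [finA _] <-]] Ae.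
exists (fset_set A); split; first exact: fset_uniq.
pose g x : \bar R := (Normc.normc (u x) ^+ 2)%:E.
have g0 x : (0 <= g x)%E by rewrite lee_fin sqr_ge0.
have uE : sqnorm u = (\sum_(x \in A) g x + \esum_(x in ~` A) g x)%E.
  by rewrite [LHS](@esumID R T A setT g)// !setTI esum_fset.
have -> : sqnorm (fun x => if x \in fset_set A then 0 else u x) =
    \esum_(x in ~` A) g x.
  rewrite [RHS]esum_mkcond; apply: eq_esum => x _.
  rewrite in_fset_set// in_setC; case: (x \in A) => //=.
  by rewrite expr0n addr0 sqrtr0 expr0n.
move: fu Ae; rewrite -/g uE fin_numD => /andP[/fineK <- /fineK <-].
by rewrite lteBlDr // -!EFinD lte_fin lee_fin; lra.
Qed.

(** Split u into a finitely supported part w and a tail r of small norm. The operators agree on w,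
    and boundedness makes both values at x small on r, so L u and L' u differ at x by less than any
    positive amount. *)
Lemma bounded_operator_ext L L' : bounded_operator L -> bounded_operator L' ->
  (forall x y, kernel_of L x y = kernel_of L' x y) ->
  forall u, ell2 u -> L u = L' u.
Proof.
move=> bL bL' LL' u lu; apply/funext => x.
have [linL [M bM]] := bL; have [linL' [M' bM']] := bL'.
apply/eqP; rewrite -subr_eq0; apply/eqP/Normc.eq0_normc/eqP.
rewrite -sqrf_eq0 eq_le sqr_ge0 andbT.
apply/ler_addgt0Pr => e e0; rewrite add0r.
(* The tail will be at most e divided by this quantity; the summand 1 keeps it positive when both
   bounds are 0. *)
have D0 : 0 < 2 * (M ^+ 2 + M' ^+ 2) + 1.
  by rewrite ltr_wpDl// mulr_ge0// addr_ge0 ?sqr_ge0.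
have [s [us tail]] := ell2_tail lu (divr_gt0 e0 D0).
set r := (fun x => _) in tail.
have lr : ell2 r by exact: le_lt_trans tail (ltry _).
pose w x := \sum_(y <- s) u y * basis_vector R y x.
have [lw Lw] := eq_kernel_finite s u bL bL' LL'.
have uE : u = (fun x => 1 * r x + w x).
  apply/funext => y; rewrite mul1r /r /w; case: ifPn => ys.
    rewrite add0r (bigD1_seq y)//= /basis_vector eqxx mulr1 big1 ?addr0// => z zy.
    by rewrite eq_sym (negbTE zy) mulr0.
  rewrite big_seq big1 ?addr0// => z zs; rewrite /basis_vector.
  by case: eqP => [yz|]; rewrite ?mulr0//; rewrite yz zs in ys.
rewrite uE linL// linL'// Lw !mul1r opprD addrACA subrr addr0.
have hL := le_trans (sqnorm_pt (L r) x) (bM _ lr).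
have hL' := le_trans (sqnorm_pt (L' r) x) (bM' _ lr).
have {}hL : Normc.normc (L r x) ^+ 2 <= M ^+ 2 * (e / (2 * (M ^+ 2 + M' ^+ 2) + 1)).
  by rewrite -lee_fin (le_trans hL)// (EFinM (M ^+ 2)) lee_wpmul2l// lee_fin sqr_ge0.
have {}hL' : Normc.normc (L' r x) ^+ 2 <= M' ^+ 2 * (e / (2 * (M ^+ 2 + M' ^+ 2) + 1)).
  by rewrite -lee_fin (le_trans hL')// (EFinM (M' ^+ 2)) lee_wpmul2l// lee_fin sqr_ge0.
(* |z - z'|^2 <= 2 |z|^2 + 2 |z'|^2 for complex z and z'. *)
apply: (@le_trans _ _ (2 * Normc.normc (L r x) ^+ 2 + 2 * Normc.normc (L' r x) ^+ 2)).
  case: (L r x) => a b; case: (L' r x) => a' b' /=.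
  rewrite !sqr_sqrtr ?addr_ge0 ?sqr_ge0//.
  have := sqr_ge0 (a + a'); have := sqr_ge0 (b + b'); nra.
apply: (@le_trans _ _ ((2 * (M ^+ 2 + M' ^+ 2)) * (e / (2 * (M ^+ 2 + M' ^+ 2) + 1)))).
  by lra.
by rewrite mulrA ler_pdivrMr// mulrC ler_pM2l// lerDl.
Qed.

Lemma kernel_cext B (x y : T) : rbounded B ->
  kernel_of (cext B) x y = (B (fun x' => (x' == y)%:R) x)%:C.
Proof.
move=> [lin _ _]; have B0 : B (fun=> 0) = (fun=> 0).
  have := lin (-1) _ _ (@l2_0 R T) (@l2_0 R T).
  rewrite (_ : (fun x : T => -1 * 0 + 0) = (fun=> 0)); last first.
    by apply/funext => z; rewrite mulr0 addr0.
  by move=> ->; apply/funext => z; rewrite mulN1r addNr.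
rewrite /kernel_of /cext (_ : imF _ = (fun=> 0)) ?B0; last first.
  by apply/funext => z; rewrite /imF /basis_vector; case: (z == y).
congr ((B _ x)%:C); apply/funext => z.
by rewrite /reF /basis_vector; case: (z == y).
Qed.

End ComplexHilbert.

(** * Gram-Schmidt orthogonalization *)

Lemma size_sum_leq (R : nzRingType) (I : Type) (r : seq I) (P : pred I)
    (F : I -> {poly R}) n :
  (forall i, P i -> (size (F i) <= n)%N) -> (size (\sum_(i <- r | P i) F i)%R <= n)%N.
Proof.
move=> Fn; elim/big_ind: _ => [|p q pn qn|//]; first by rewrite size_poly0.
by rewrite (leq_trans (size_polyD _ _))// geq_max pn.
Qed.

Section GramSchmidt.
Variables (R : realType) (X : set R) (w : R -> R) (N : nat).
Implicit Types (p q r : {poly R}) (n m : nat).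

Local Notation wdot := (wdot X w).
Local Notation orth_poly := (orth_poly X w).

Hypothesis wdotC : forall p q, wdot p q = wdot q p.
(** Linearity and definiteness are restricted to degree less than N: the moments of the weight are
    controlled only up to order 2N - 2, and only N points are known to carry positive weight. *)
Hypothesis wdotDr : forall (c : R) r p q,
  (size r <= N)%N -> (size p <= N)%N -> (size q <= N)%N ->
  wdot r (c *: p + q) = c * wdot r p + wdot r q.
Hypothesis wdot_neq0 : forall p, (size p <= N)%N -> p != 0 -> wdot p p != 0.

Lemma gram_schmidtE n : gram_schmidt X w n = [seq orth_poly i | i <- iota 0 n].
Proof.
elim: n => // n IH; rewrite -{2}(addn1 n) iotaD map_cat -IH /= cats1 add0n.
congr rcons; rewrite /Defs.orth_poly /= nth_rcons.
by rewrite (_ : size _ = n) ?ltnn ?eqxx// IH size_map size_iota.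
Qed.

Lemma orth_polyE n : orth_poly n =
  'X^n - \sum_(i < n) (wdot 'X^n (orth_poly i) / wdot (orth_poly i) (orth_poly i))
                      *: orth_poly i.
Proof.
rewrite {1}/Defs.orth_poly /= nth_rcons (_ : size _ = n); last first.
  by rewrite gram_schmidtE size_map size_iota.
rewrite ltnn eqxx gram_schmidtE big_map -[in iota 0 n](subn0 n).
by rewrite -/(index_iota 0 n) big_mkord.
Qed.

Lemma size_orth_poly n : size (orth_poly n) = n.+1.
Proof.
elim/ltn_ind: n => n IH; rewrite orth_polyE size_polyDl size_polyXn// size_polyN ltnS.
by apply: size_sum_leq => i _; rewrite (leq_trans (size_scale_leq _ _))// IH.
Qed.

Lemma orth_poly_neq0 n : orth_poly n != 0.
Proof. by rewrite -size_poly_gt0 size_orth_poly. Qed.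

Lemma size_sum_orth n (c : nat -> R) :
  (size (\sum_(i < n) c i *: orth_poly i)%R <= n)%N.
Proof.
by apply: size_sum_leq => i _; rewrite (leq_trans (size_scale_leq _ _))//
  size_orth_poly.
Qed.

Lemma orth_poly_span n p : (size p <= n)%N ->
  exists c : nat -> R, p = \sum_(i < n) c i *: orth_poly i.
Proof.
elim: n p => [|n IH] p sp.
  by exists (fun=> 0); rewrite big_ord0; apply/eqP; rewrite -size_poly_leq0.
have [|c cE] := IH (p - p`_n *: orth_poly n).
  apply/leq_sizeP => j nj; rewrite coefB coefZ.
  have := nj; rewrite leq_eqVlt => /predU1P[<-|{}nj].
    have -> : (orth_poly n)`_n = 1.
      rewrite orth_polyE coefB coefXn eqxx nth_default ?subr0//.
      exact: (size_sum_orth n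
        (fun i => wdot 'X^n (orth_poly i) / wdot (orth_poly i) (orth_poly i))).
    by rewrite mulr1 subrr.
  rewrite [p`_j]nth_default ?(leq_trans sp)//.
  by rewrite [_`_j]nth_default ?size_orth_poly// mulr0 subr0.
exists (fun i => if i == n then p`_n else c i).
rewrite big_ord_recr /= eqxx; under eq_bigr do rewrite ltn_eqF//.
by rewrite -cE subrK.
Qed.

Lemma wdot_sumr r n (c : nat -> R) : (size r <= N)%N -> (n <= N)%N ->
  wdot r (\sum_(i < n) c i *: orth_poly i) =
  \sum_(i < n) c i * wdot r (orth_poly i).
Proof.
move=> sr; elim: n => [_|n IH nN].
  have s0 : (size (0%R : {poly R}) <= N)%N by rewrite size_poly0.
  rewrite !big_ord0; have := wdotDr 1 sr s0 s0; rewrite scaler0 addr0; lra.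
rewrite !big_ord_recr /= addrC wdotDr//; last 2 first.
- by rewrite size_orth_poly.
- exact: leq_trans (size_sum_orth _ _) (ltnW nN).
by rewrite IH 1?ltnW// addrC.
Qed.

(** Strong induction on the larger index: in the Gram-Schmidt formula for [orth_poly n], pairing
    with [orth_poly m] kills every subtracted term except i = m, and that one cancels the
    contribution of 'X^n. *)
Lemma orth_poly_lt n m : (m < n)%N -> (n < N)%N ->
  wdot (orth_poly m) (orth_poly n) = 0.
Proof.
elim/ltn_ind: n m => n IH m mn nN.
have mN : (size (orth_poly m) <= N)%N by rewrite size_orth_poly (ltn_trans mn).
pose c i := - (wdot 'X^n (orth_poly i) / wdot (orth_poly i) (orth_poly i)).
have -> : orth_poly n = 1 *: (\sum_(i < n) c i *: orth_poly i) + 'X^n.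
  rewrite scale1r orth_polyE addrC -sumrN; congr (_ + _).
  by apply: eq_bigr => i _; rewrite -scaleNr.
rewrite wdotDr// ?size_polyXn//; last exact: leq_trans (size_sum_orth _ _) (ltnW nN).
rewrite mul1r wdot_sumr// 1?ltnW// (bigD1 (Ordinal mn))//= big1 => [|i im].
  by rewrite addr0 /c mulNr divfK ?wdot_neq0 ?orth_poly_neq0// wdotC addNr.
rewrite (_ : wdot _ _ = 0) ?mulr0//.
have : (i != m :> nat) by [].
rewrite neq_ltn => /orP[im'|mi]; last by apply: IH => //; exact: ltn_trans nN.
by rewrite wdotC; apply: IH => //; exact: ltn_trans nN.
Qed.

Lemma orth_poly_orth n m : n != m -> (n < N)%N -> (m < N)%N ->
  wdot (orth_poly n) (orth_poly m) = 0.
Proof.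
rewrite neq_ltn => /orP[nm|mn] nN mN; first exact: orth_poly_lt.
by rewrite wdotC orth_poly_lt.
Qed.

End GramSchmidt.

(** * Lagrange interpolation *)

Section Lagrange.
Variables (R : fieldType) (s : seq R).
Implicit Types (p : {poly R}) (y z : R).

(** The Lagrange basis polynomial at y, before division by its value at y. *)
Definition node_poly y : {poly R} := \prod_(z <- s | z != y) ('X - z%:P).

Lemma node_polyE y x : (node_poly y).[x] = \prod_(z <- s | z != y) (x - z).
Proof.
by rewrite /node_poly horner_prod; apply: eq_bigr => z _; rewrite hornerXsubC.
Qed.

Lemma node_poly_eq0 y z : z \in s -> z != y -> (node_poly y).[z] = 0.
Proof. by move=> zs zy; rewrite node_polyE (big_rem z)//= zy subrr mul0r. Qed.

Lemma node_poly_neq0 y : (node_poly y).[y] != 0.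
Proof.
rewrite node_polyE; elim/big_ind: _ => [|a b|z zy]; first exact: oner_neq0.
  exact: mulf_neq0.
by rewrite subr_eq0 eq_sym.
Qed.

Hypothesis us : uniq s.

Lemma size_node_poly y : y \in s -> size (node_poly y) = size s.
Proof.
move=> ys; rewrite /node_poly -big_filter size_prod_XsubC.
have := count_predC (pred1 y) s.
by rewrite (count_uniq_mem y us) ys add1n -size_filter => <-.
Qed.

Lemma poly_nodes_inj p : (size p <= size s)%N ->
  (forall y, y \in s -> p.[y] = 0) -> p = 0.
Proof.
move=> sp p0; apply/eqP; apply: contraT => pn0.
have/(max_poly_roots pn0) : all (root p) s by apply/allP => y ys; apply/rootP/p0.
by rewrite ltnNge sp => /(_ us).
Qed.

(** The difference of the two sides vanishes at all nodes and has too small a degree to be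
    nonzero. *)
Lemma Lagrange p : (size p <= size s)%N ->
  p = \sum_(y <- s) (p.[y] / (node_poly y).[y]) *: node_poly y.
Proof.
move=> sp; apply/eqP; rewrite -subr_eq0; apply/eqP; apply: poly_nodes_inj.
  rewrite (leq_trans (size_polyD _ _))// geq_max sp size_polyN big_seq.
  apply: size_sum_leq => y ys.
  by rewrite (leq_trans (size_scale_leq _ _))// size_node_poly.
move=> y ys; rewrite hornerD hornerN horner_sum (bigD1_seq y)//= hornerZ.
rewrite divfK ?node_poly_neq0// big1 ?addr0 ?subrr// => z zy.
by rewrite hornerZ [(node_poly z).[y]]node_poly_eq0 ?mulr0// eq_sym.
Qed.

End Lagrange.

(** This is the reason for the signs [eps]: they undo the absolute value produced by the square root
    of the weight. *)
Lemma sg_sqrt_div (R : rcfType) (h a : R) : 0 <= h -> a != 0 ->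
  Num.sg a * Num.sqrt (h ^+ 2 / a ^+ 2) = h / a.
Proof.
move=> h0 a0; rewrite -exprVn -exprMn sqrtr_sqr normrM ger0_norm// normfV.
by case: sgrP a0 => [//|_ _|_ _]; rewrite ?mul1r// invrN mulN1r mulrN opprK.
Qed.

(** * Sums over a set as sums over its subtype *)

Section SetType.
Variables (R : realType) (X : set R).

Lemma nnsum_val (F : R -> R) :
  nnsum (fun x : X => F (val x)) = \esum_(x in X) (F x)%:E.
Proof.
have valX : (val @` [set: X])%classic = X.
  apply/seteqP; split=> [_ [x _ <-]|x Xx]; first exact: set_valP.
  by exists (SigSub (mem_set Xx)).
rewrite -[in RHS]valX [RHS]esum_image// => x y _ _; exact: val_inj.
Qed.

Lemma sum_over_val (F : R -> R) : sum_over X F = rsum (fun x : X => F (val x)).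
Proof.
by rewrite /sum_over /rsum -(nnsum_val (fun x => Num.max (F x) 0))
  -(nnsum_val (fun x => Num.max (- F x) 0)).
Qed.

End SetType.

(** * The operator L and the Christoffel-Darboux projection *)

Section Model.
Variables (R : realType) (X XI : set R) (XII : {fset R}) (hI hII : R -> R).
Hypotheses (HX : X = (XI `|` [set` XII])%classic)
  (Hdisj : (XI `&` [set` XII])%classic = set0)
  (Hlim : limit_point X = set0)
  (HhI : forall x, XI x -> 0 <= hI x)
  (HhI_sum : (\esum_(x in XI) (hI x ^+ 2 / (1 + x ^+ 2))%:E < +oo)%E)
  (HhII : forall x, x \in XII -> 0 < hII x).

Local Notation w := (weight XII hI hII).
Local Notation N := (#|` XII |).
Local Notation eps := (eps XII).
Implicit Types (x : X) (y z : R) (p q : {poly R}) (u v : X -> R).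

Lemma XI_X y : XI y -> X y. Proof. by rewrite HX; left. Qed.

Lemma XI_notin y : XI y -> y \notin XII.
Proof.
by move=> Iy; apply/negP => IIy; rewrite -[False]/(set0 y) -Hdisj; split.
Qed.

Lemma X_XI y : X y -> y \notin XII -> XI y.
Proof. by rewrite HX => -[//|/= ->]. Qed.

Lemma XII_pt y : y \in XII -> exists x, val x = y.
Proof.
move=> yII; have Xy : X y by rewrite HX; right.
by exists (SigSub (mem_set Xy)).
Qed.

(** Both branches are put in the form h^2 / a^2 that [sg_sqrt_div] expects, with h = 1 on XII. *)
Lemma weightE y : w y = if y \in XII
  then 1 ^+ 2 / (hII y * (node_poly XII y).[y]) ^+ 2
  else hI y ^+ 2 / (\prod_(z <- XII) (y - z)) ^+ 2.
Proof.
by rewrite /weight !prodrXl node_polyE -exprMn expr1n mul1r.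
Qed.

Lemma weight_ge0 y : 0 <= w y.
Proof. by rewrite weightE; case: ifP => _; rewrite mulr_ge0 ?invr_ge0 ?sqr_ge0. Qed.

Lemma prod_XII_neq0 y : y \notin XII -> \prod_(z <- XII) (y - z) != 0.
Proof.
move=> yII; rewrite big_seq; elim/big_ind: _ => [|a b|z zII].
- exact: oner_neq0.
- exact: mulf_neq0.
- by rewrite subr_eq0; apply: contraNneq yII => ->.
Qed.

(** * The embedding of polynomials and the graph of A *)

Lemma eps_sqr y : eps y ^+ 2 = 1.
Proof.
rewrite /eps; case: ifPn => yII; rewrite sqr_sg.
  by rewrite -(node_polyE XII) node_poly_neq0.
by rewrite prod_XII_neq0.
Qed.

(** The embedding of polynomials into functions on X; the image of the polynomials of degree less
    than N is the space V. *)
Definition psi p x : R := eps (val x) * Num.sqrt (w (val x)) * p.[val x].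

Lemma psiE p x : psi p x = (if val x \in XII
  then (hII (val x) * (node_poly XII (val x)).[val x])^-1
  else hI (val x) / \prod_(z <- XII) (val x - z)) * p.[val x].
Proof.
rewrite /psi weightE /eps; case: ifPn => xII; congr (_ * _).
  rewrite -[RHS]mul1r -[RHS]sg_sqrt_div ?mulf_neq0 ?node_poly_neq0 ?gt_eqF ?HhII//.
  by rewrite sgrM (gtr0_sg (HhII xII)) mul1r node_polyE.
by rewrite sg_sqrt_div ?prod_XII_neq0//; apply/HhI/X_XI => //; exact: set_valP.
Qed.

(** The column A e_y, extended by 0 to XII; [ecol y] is e_y itself. The index y is a real number
    rather than a point of the subtype, so that sums can run over XII directly. *)
Definition acol y x : R := if val x \in XII then 0 else A_kernel hI hII (val x) y.

Definition ecol y x : R := (val x == y)%:R.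

Definition graph_col y x : R := acol y x + ecol y x.

(** On XI, dividing the node polynomial by the full product leaves 1 / (x - y), hence A(x,y). On XII
    the node polynomial vanishes except at y, where the normalization gives 1. *)
Lemma psi_node y x : y \in XII -> psi (hII y *: node_poly XII y) x = graph_col y x.
Proof.
move=> yII; rewrite psiE hornerZ /graph_col /acol /ecol /A_kernel.
case: ifPn => xII; last first.
  have xy : val x != y by apply: contraNneq xII => ->.
  have prodE : \prod_(z <- XII) (val x - z) = (val x - y) * (node_poly XII y).[val x].
    by rewrite node_polyE (bigD1_seq y)//= fset_uniq.
  have := prod_XII_neq0 xII; rewrite prodE mulf_eq0 negb_or => /andP[xy0 n0].
  by rewrite (negbTE xy) addr0; field; rewrite xy0 n0.
rewrite add0r; case: eqP => [->|/eqP xy].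
  by rewrite mulVf// mulf_neq0 ?node_poly_neq0// gt_eqF// HhII.
by rewrite (node_poly_eq0 xII xy) !mulr0.
Qed.

Lemma XI_separated y : y \in XII ->
  exists2 d, 0 < d & forall z, XI z -> d <= `|z - y|.
Proof.
move=> yII; have : ~ limit_point X y by rewrite Hlim.
rewrite /limit_point/= -existsNE => -[U /not_implyP[/nbhs_ballP[d/= d0 dU] nU]].
exists d => // z Iz; rewrite leNgt; apply/negP => zyd; apply: nU; exists z; split.
- by apply: contraTneq (XI_notin Iz) => ->; rewrite negbK.
- exact: XI_X.
- by apply: dU; rewrite /ball/= distrC.
Qed.

Lemma l2_ecol y : l2 (ecol y : X -> R).
Proof.
have [yX|yX] := pselect (X y).
  apply: (@l2_single _ _ _ (SigSub (mem_set yX))) => x /negbTE xy.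
  by rewrite /ecol -[y]/(val (SigSub (mem_set yX))) (inj_eq val_inj) xy.
apply: eq_abs_summable (@l2_0 R X) => x; rewrite /ecol.
by case: eqP => // xy; case: yX; rewrite -xy; exact: set_valP.
Qed.

Lemma abs_summable_hI : abs_summable (fun x =>
  if val x \in XII then 0 else hI (val x) ^+ 2 / (1 + val x ^+ 2)).
Proof.
pose F z := if z \in XII then 0 else hI z ^+ 2 / (1 + z ^+ 2).
have F0 z : 0 <= F z.
  by rewrite /F; case: ifP => // _; rewrite divr_ge0 ?addr_ge0 ?sqr_ge0.
rewrite /abs_summable (@eq_nnsum _ _ _ (fun x => F (val x))); last first.
  by move=> x; rewrite ger0_norm// F0.
rewrite nnsum_val (le_lt_trans _ HhI_sum)// esum_mkcond [leRHS]esum_mkcond.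
apply: le_esum => z _; case: ifPn => [|_]; last first.
  by case: ifP => // _; rewrite lee_fin divr_ge0 ?addr_ge0 ?sqr_ge0.
rewrite inE => Xz; rewrite /F; case: ifPn => zII.
  by case: ifP => // _; rewrite lee_fin divr_ge0 ?addr_ge0 ?sqr_ge0.
by rewrite mem_set//; exact: X_XI.
Qed.

(* As y is isolated in X, (x - y)^2 >= c (1 + x^2) for all x in XI. *)
Lemma l2_acol y : y \in XII -> l2 (acol y : X -> R).
Proof.
move=> yII; have [d d0 dz] := XI_separated yII.
(* 1 + x^2 <= 1 + 2 y^2 + 2 (x - y)^2, and d^2 <= (x - y)^2 absorbs the constant term, so 1 + x^2 <=
   C (x - y)^2. *)
pose C := (1 + 2 * y ^+ 2) / d ^+ 2 + 2.
apply: le_abs_summable (abs_summableZ (hII y ^+ 2 * C) abs_summable_hI) => x.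
rewrite /acol; case: ifPn => xII; first by rewrite expr0n/= normr0 normr_ge0.
rewrite ger0_norm ?sqr_ge0// (le_trans _ (ler_norm _))// /A_kernel.
have Ix : XI (val x) by apply: X_XI => //; exact: set_valP.
have xy0 : 0 < (val x - y) ^+ 2.
  by rewrite lt0r sqr_ge0 andbT sqrf_eq0 subr_eq0; apply: contraNneq xII => ->.
have x20 : 0 < 1 + val x ^+ 2 by rewrite ltr_pwDl// sqr_ge0.
have dxy : d ^+ 2 <= (val x - y) ^+ 2.
  rewrite -[leRHS]real_normK ?num_real// lerXn2r ?nnegrE ?normr_ge0 ?dz//.
  exact: ltW.
rewrite !exprMn exprVn [leLHS]mulrAC [leLHS]mulrC.
rewrite [leRHS](_ : _ = hII y ^+ 2 * (hI (val x) ^+ 2 * (C / (1 + val x ^+ 2)))).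
  rewrite !ler_wpM2l ?sqr_ge0// ler_pdivlMr// mulrC ler_pdivrMr//.
  have h : 1 + 2 * y ^+ 2 <= (1 + 2 * y ^+ 2) / d ^+ 2 * (val x - y) ^+ 2.
    have y20 : 0 <= 1 + 2 * y ^+ 2 by have := sqr_ge0 y; lra.
    by rewrite mulrAC ler_pdivlMr ?exprn_gt0// ler_wpM2l.
  rewrite /C mulrDl; apply: le_trans (lerD h (lexx _)).
  by have := sqr_ge0 (val x - 2 * y); nra.
by ring.
Qed.

Lemma l2_graph_col y : y \in XII -> l2 (graph_col y : X -> R).
Proof.
move=> yII; apply: eq_abs_summable (l2D 1 (l2_acol yII) (l2_ecol y)) => x.
by rewrite mul1r.
Qed.

Lemma psiZD (c : R) p q x : psi (c *: p + q) x = c * psi p x + psi q x.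
Proof. by rewrite /psi hornerD hornerZ; ring. Qed.

Lemma psi_sum (I : Type) (r : seq I) (c : I -> R) (p : I -> {poly R}) x :
  psi (\sum_(i <- r) c i *: p i) x = \sum_(i <- r) c i * psi (p i) x.
Proof.
elim: r => [|i r IH]; first by rewrite !big_nil /psi horner0 mulr0.
by rewrite !big_cons psiZD IH.
Qed.

(* Lagrange interpolation on XII: psi p belongs to the graph of A. *)
Lemma psi_graph p : (size p <= N)%N -> exists c : R -> R,
  psi p = (fun x => \sum_(y <- XII) c y * graph_col y x).
Proof.
move=> sp; exists (fun y => p.[y] / (node_poly XII y).[y] / hII y).
apply/funext => x; rewrite {1}(Lagrange (fset_uniq XII) sp) psi_sum.
rewrite big_seq [RHS]big_seq; apply: eq_bigr => y yII.
rewrite -psi_node// -[hII y *: _]addr0 psiZD.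
rewrite [psi 0 _](_ : _ = 0) ?addr0; last by rewrite /psi horner0 mulr0.
by field; rewrite gt_eqF ?HhII// node_poly_neq0.
Qed.

Lemma l2_psi p : (size p <= N)%N -> l2 (psi p).
Proof. by move=> /psi_graph[c ->]; apply: l2_sum => y; exact: l2_graph_col. Qed.

Lemma dot_ecol u x : dot (ecol (val x)) u = u x.
Proof.
rewrite (@dot_single _ _ _ _ x) /ecol ?eqxx ?mul1r// => z.
by rewrite (inj_eq val_inj) => /negbTE ->.
Qed.

Lemma sum_ecol (F : R -> R) x :
  \sum_(y <- XII) F y * ecol y x = if val x \in XII then F (val x) else 0.
Proof.
case: ifPn => xII; last first.
  rewrite big_seq big1// => y yII; rewrite /ecol; case: eqP => [xy|]; rewrite ?mulr0//.
  by rewrite xy yII in xII.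
rewrite (bigD1_seq (val x)) ?fset_uniq// /ecol eqxx mulr1 big1 => [|y yx].
  exact: addr0.
by rewrite eq_sym (negbTE yx) mulr0.
Qed.

(** The coefficients in the graph representation are the values on XII, because there [acol]
    vanishes. *)
Lemma psi_graphE p x : (size p <= N)%N ->
  psi p x = \sum_(y <- XII) dot (ecol y) (psi p) * graph_col y x.
Proof.
move=> sp; have [c pE] := psi_graph sp; rewrite {1}pE big_seq [RHS]big_seq.
apply: eq_bigr => y yII; congr (_ * _); have [t ty] := XII_pt yII.
rewrite -ty dot_ecol pE /graph_col; under eq_bigr do rewrite mulrDr.
rewrite big_split sum_ecol ty yII big1 => [|z _]; first exact/esym/add0r.
by rewrite /acol ty yII mulr0.
Qed.

(** The signs square to 1, so [psi] carries the weighted inner product to that of l^2. *)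
Lemma wdotE p q : wdot X w p q = dot (psi p) (psi q).
Proof.
rewrite /wdot sum_over_val; apply: eq_rsum => x; rewrite /psi.
transitivity (eps (val x) ^+ 2 * Num.sqrt (w (val x)) ^+ 2 * (p.[val x] * q.[val x])).
  by rewrite eps_sqr sqr_sqrtr ?weight_ge0// mul1r mulrC.
by ring.
Qed.

(** A polynomial of zero norm would vanish at the N points of XII, where the weight is positive, and
    so be zero. *)
Lemma wdot_neq0 p : (size p <= N)%N -> p != 0 -> wdot X w p p != 0.
Proof.
move=> sp; apply: contraNneq; rewrite wdotE => p0.
apply/eqP/(poly_nodes_inj (fset_uniq XII) sp) => y yII.
have [x xy] := XII_pt yII; have := dot_pt x (l2_psi sp); rewrite p0.
rewrite le_eqVlt ltNge sqr_ge0 orbF sqrf_eq0 psiE xy yII mulf_eq0 invr_eq0.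
by rewrite mulf_eq0 gt_eqF ?HhII// (negbTE (node_poly_neq0 _ _)) => /eqP.
Qed.

(** * The orthogonal projection on V *)

Local Notation P := (orth_poly X w).
Local Notation h n := (wdot X w (P n) (P n)).

Lemma wdotC p q : wdot X w p q = wdot X w q p.
Proof. by rewrite !wdotE dotC. Qed.

Lemma wdotDr (c : R) (r p q : {poly R}) :
  (size r <= N)%N -> (size p <= N)%N -> (size q <= N)%N ->
  wdot X w r (c *: p + q) = c * wdot X w r p + wdot X w r q.
Proof.
move=> sr sp sq; rewrite !wdotE -dotDr; [|exact: l2_psi..].
by congr dot; apply/funext => x; exact: psiZD.
Qed.

Lemma size_orth_leq (n : 'I_N) : (size (P n) <= N)%N.
Proof. by rewrite size_orth_poly. Qed.

Lemma orth_norm_neq0 (n : 'I_N) : h n != 0.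
Proof.
by rewrite wdot_neq0 ?size_orth_leq//; exact: orth_poly_neq0.
Qed.

Lemma orth_polys_dot (n m : 'I_N) :
  dot (psi (P n)) (psi (P m)) = if n == m then h n else 0.
Proof.
case: eqVneq => [->|nm]; rewrite -wdotE//.
exact: (orth_poly_orth wdotC wdotDr wdot_neq0).
Qed.

(** The projection Q, written as [psi] of a polynomial so that its values lie in V by
    construction. *)
Definition proj u : X -> R :=
  psi (\sum_(n < N) (dot (psi (P n)) u / h n) *: P n).

Lemma size_proj u : (size (\sum_(n < N) (dot (psi (P n)) u / h n) *: P n)%R <= N)%N.
Proof.
by apply: size_sum_leq => n _;
  rewrite (leq_trans (size_scale_leq _ _))// size_orth_leq.
Qed.

Lemma projE u x :
  proj u x = \sum_(n < N) (dot (psi (P n)) u / h n) * psi (P n) x.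
Proof. exact: psi_sum. Qed.

Lemma l2_proj u : l2 (proj u).
Proof. exact/l2_psi/size_proj. Qed.

(** The orthogonal polynomials span, so it suffices to test against each [psi (P n)]; by
    orthogonality only the n-th term of [proj u] contributes, and it cancels the pairing with u. *)
Lemma dot_proj_orth u p : l2 u -> (size p <= N)%N ->
  dot (psi p) (fun x => -1 * proj u x + u x) = 0.
Proof.
move=> lu sp; have lw := l2D (-1) (l2_proj u) lu.
have [c ->] := orth_poly_span X w sp.
rewrite (_ : psi _ = fun x => \sum_(n < N) c n * psi (P n) x); last first.
  by apply/funext => x; rewrite psi_sum.
have lP (n : 'I_N) : l2 (psi (P n)) by exact/l2_psi/size_orth_leq.
have lq := l2_proj u.
rewrite dotC dot_sumr//= big1 // => n _; rewrite dotC dotDr//.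
rewrite (_ : proj u = fun x => \sum_(m < N) (dot (psi (P m)) u / h m) * psi (P m) x);
  last by apply/funext => x; rewrite projE.
rewrite dot_sumr// (bigD1 n)//= orth_polys_dot eqxx divfK ?orth_norm_neq0//.
rewrite big1 => [|m mn]; first by rewrite addr0 mulN1r addNr mulr0.
by rewrite orth_polys_dot eq_sym (negbTE mn) mulr0.
Qed.

(** * L and the inverse of 1 + L on real functions *)

Definition Lop u x : R :=
  \sum_(y <- XII) (dot (ecol y) u * acol y x + dot (acol y) u * - ecol y x).

(** The candidate S. The indicator of XI and the sign (-1 on XI, 1 on XII) merge the cases u - Q u
    and Q u into one mask plus N rank-one operators, a form from which boundedness is immediate. *)
Definition Sop u x : R := (val x \notin XII)%:R * u x +
  \sum_(n < N) dot (psi (P n)) u *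
    ((-1) ^+ (val x \notin XII) * psi (P n) x / h n).

Lemma SopE u x : Sop u x = if val x \in XII then proj u x else u x - proj u x.
Proof.
rewrite /Sop; case: ifPn => _ /=.
  rewrite mul0r add0r expr0 projE; apply: eq_bigr => n _; ring.
rewrite mul1r expr1 projE -sumrN; congr (_ + _); apply: eq_bigr => n _; ring.
Qed.

Lemma Lop_bounded : rbounded Lop.
Proof.
apply: rbounded_sum => y yII; apply: rboundedD; apply: rbounded_rank1.
- exact: l2_acol.
- exact: l2_ecol.
- by apply: eq_abs_summable (l2Z (-1) (l2_ecol y)) => x; rewrite mulN1r.
- exact: l2_acol.
Qed.

Lemma Sop_bounded : rbounded Sop.
Proof.
apply: rboundedD.
  by apply: rbounded_mask => x; case: (_ \notin _); rewrite ?normr1 ?normr0 ?ler01.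
apply: rbounded_sum => n _; apply: rbounded_rank1; last exact/l2_psi/size_orth_leq.
apply: eq_abs_summable (l2Z (h n)^-1 (l2_psi (size_orth_leq n))) => x.
by rewrite !exprMn sqrr_sign mul1r mulrC.
Qed.

Lemma Lop_acol u x : val x \notin XII ->
  Lop u x = \sum_(y <- XII) dot (ecol y) u * acol y x.
Proof.
move=> xII; rewrite /Lop big_seq [RHS]big_seq; apply: eq_bigr => y yII.
rewrite (_ : ecol y x = 0) ?oppr0 ?mulr0 ?addr0// /ecol.
by case: eqP => // xy; rewrite xy yII in xII.
Qed.

Lemma Lop_ecol u x : val x \in XII -> Lop u x = - dot (acol (val x)) u.
Proof.
move=> xII; transitivity (- \sum_(y <- XII) dot (acol y) u * ecol y x).
  rewrite -sumrN; apply: eq_bigr => y _.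
  by rewrite [acol y x](_ : _ = 0) ?mulr0 ?add0r ?mulrN// /acol xII.
by rewrite (sum_ecol (fun y => dot (acol y) u)) xII.
Qed.

(* [Sop v] agrees with [v - proj v], orthogonal to the graph of A, on X_I, and with
   [proj v], which belongs to it, on X_II. *)
Lemma Sop_rightinv v x : l2 v -> Sop v x + Lop (Sop v) x = v x.
Proof.
move=> lv; pose r x' := -1 * proj v x' + v x'.
have lr : l2 r by exact: l2D (l2_proj v) lv.
rewrite SopE; case: ifPn => xII.
  rewrite Lop_ecol// (_ : dot _ _ = dot (acol (val x)) r); last first.
    apply: eq_rsum => z; rewrite SopE /acol /r; case: ifPn => _; first by rewrite !mul0r.
    by ring.
  (* The remainder r = v - Q v is orthogonal to the graph vector A e_x + e_x, so the pairing of A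
     e_x with r is - r(x), and L contributes r(x). *)
  have : dot (psi (hII (val x) *: node_poly XII (val x))) r = 0.
    apply: dot_proj_orth => //.
    by rewrite (leq_trans (size_scale_leq _ _))// (size_node_poly (fset_uniq XII)).
  rewrite (_ : psi _ = fun x' => 1 * acol (val x) x' + ecol (val x) x'); last first.
    by apply/funext => x'; rewrite psi_node// mul1r.
  rewrite dotC dotDr//; [|exact: l2_acol|exact: l2_ecol].
  by rewrite !(dotC r) dot_ecol /r; lra.
rewrite Lop_acol//.
(* On XII, [Sop v] is Q v. As Q v lies in the graph, A maps these values to those of Q v on XI. *)
have -> : \sum_(y <- XII) dot (ecol y) (Sop v) * acol y x = proj v x.
  rewrite [RHS]psi_graphE ?size_proj// -/(proj v) big_seq [RHS]big_seq.
  apply: eq_bigr => y yII; have [t ty] := XII_pt yII.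
  rewrite -ty !dot_ecol SopE ty yII; congr (_ * _).
  rewrite /graph_col (_ : ecol y x = 0) ?addr0// /ecol.
  by case: eqP => // xy; rewrite xy yII in xII.
by rewrite subrK.
Qed.

Lemma l2_Lop u : l2 u -> l2 (Lop u).
Proof. by case: Lop_bounded => _ + _; exact. Qed.

Lemma l2_Sop u : l2 u -> l2 (Sop u).
Proof. by case: Sop_bounded => _ + _; exact. Qed.

(** Antisymmetry of L: for each y the two rank-one terms contribute opposite products. *)
Lemma dot_Lop u : l2 u -> dot u (Lop u) = 0.
Proof.
move=> lu; pose B y x := dot (ecol y) u * acol y x + - dot (acol y) u * ecol y x.
have lE y := l2Z (- dot (acol y) u) (l2_ecol y).
have lB y : y \in XII -> l2 (B y) by move=> yII; exact: l2D (l2_acol yII) (lE y).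
have -> : Lop u = (fun x => \sum_(y <- XII) 1 * B y x).
  by apply/funext => x; apply: eq_bigr => y _; rewrite mul1r /B mulrN mulNr.
rewrite dot_sumr// big_seq big1// => y yII.
rewrite mul1r (dotDr _ lu (l2_acol yII) (lE y)) (dotZr _ lu (l2_ecol y)).
by rewrite (dotC u (acol y)) (dotC u (ecol y)) mulNr mulrC subrr.
Qed.

(** With v = u + L u, the right inverse property gives d + L d = 0 for d = S v - u. Pairing with d
    leaves [dot d d = 0], so d vanishes. *)
Lemma Sop_leftinv u : l2 u -> Sop (fun x => u x + Lop u x) = u.
Proof.
move=> lu; set v := (fun x => _).
have lv : l2 v.
  by apply: eq_abs_summable (l2D 1 lu (l2_Lop lu)) => x; rewrite mul1r.
have lS := l2_Sop lv.
pose d x := -1 * u x + Sop v x.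
have ld : l2 d by exact: l2D.
have [linL _ _] := Lop_bounded.
have d0 : (fun x => 1 * d x + Lop d x) = (fun x => 0 * d x + 0).
  apply/funext => x; rewrite linL//; have := Sop_rightinv x lv.
  by rewrite /d /v; lra.
have : dot d (fun x => 1 * d x + Lop d x) = 0.
  rewrite d0 (_ : (fun x => _) = (fun x => 0 * d x)).
    by rewrite dotZr// mul0r.
  by apply/funext => x; rewrite addr0.
rewrite dotDr//; last exact: l2_Lop.
rewrite dot_Lop// mul1r addr0 => dd0.
apply/funext => x; have := dot_pt x ld; rewrite dd0 => dx.
have /eqP : d x == 0 by rewrite -sqrf_eq0 eq_le dx sqr_ge0.
by rewrite /d; lra.
Qed.

(** * Matrix entries of L, Q and S *)

Lemma dot_delta u (y : X) : dot u (fun x => (x == y)%:R) = u y.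
Proof.
by rewrite dotC (@dot_single _ _ _ _ y) ?eqxx ?mul1r// => x /negbTE ->.
Qed.

Lemma Lop_delta (x y : X) : Lop (fun x' => (x' == y)%:R) x =
  L_kernel XII hI hII (val x) (val y).
Proof.
rewrite /L_kernel; case: ifPn => xII.
  rewrite Lop_ecol// dot_delta /acol; case: ifPn; rewrite ?oppr0//.
rewrite Lop_acol//; transitivity (\sum_(z <- XII) acol z x * ecol z y).
  by apply: eq_bigr => z _; rewrite dot_delta mulrC.
by rewrite (sum_ecol (fun z => acol z x)) /acol (negbTE xII).
Qed.

Lemma proj_delta (x y : X) : proj (fun x' => (x' == y)%:R) x =
  eps (val x) * CD_kernel X w N (val x) (val y) * eps (val y).
Proof.
rewrite projE /CD_kernel sqrtrM ?weight_ge0// !(mulr_sumr, mulr_suml).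
by apply: eq_bigr => n _; rewrite dot_delta /psi; ring.
Qed.

(** This is S = 1 - K entrywise. For x in XII the identity inside [particle_hole] survives
    conjugation by [eps] and cancels the outer one. *)
Lemma Sop_delta (x y : X) : Sop (fun x' => (x' == y)%:R) x = (x == y)%:R -
  eps (val x) * particle_hole XII (CD_kernel X w N) (val x) (val y) * eps (val y).
Proof.
have dE : eps (val x) * (val x == val y)%:R * eps (val y) = (x == y)%:R.
  rewrite (inj_eq val_inj); case: eqP => [->|_]; last by rewrite mulr0 mul0r.
  by rewrite mulr1 -expr2 eps_sqr.
rewrite SopE proj_delta /particle_hole; case: ifPn => // _.
by rewrite mulrBr mulrBl dE opprB addrC subrK.
Qed.

End Model.

(** * Transfer to operators on complex l^2 *)

Theorem theorem5p10 (R : realType) (N : nat)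
    (X XI : set R) (XII : {fset R}) (hI hII : R -> R)
    (HX : X = (XI `|` [set` XII])%classic)
    (Hdisj : (XI `&` [set` XII])%classic = set0)
    (Hcount : countable X)
    (Hlim : limit_point X = set0)
    (HN : #|` XII | = N)
    (HhI : forall x, XI x -> 0 <= hI x)
    (HhI_sum : (\esum_(x in XI) (hI x ^+ 2 / (1 + x ^+ 2))%:E < +oo)%E)
    (HhII : forall x, x \in XII -> 0 < hII x) :
  let f := weight XII hI hII in
  let KCD := CD_kernel X f N in
  (exists L : (X -> R[i]) -> (X -> R[i]),
     bounded_operator L /\
     forall x y : X,
       kernel_of L x y = (L_kernel XII hI hII (val x) (val y))%:C) /\
  (forall L : (X -> R[i]) -> (X -> R[i]),
     bounded_operator L ->
     (forall x y : X,
       kernel_of L x y = (L_kernel XII hI hII (val x) (val y))%:C) ->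
     exists S : (X -> R[i]) -> (X -> R[i]),
       bounded_inverse (one_plus L) S /\
       forall x y : X,
         kernel_of (L \o S) x y =
         (eps XII (val x) * particle_hole XII KCD (val x) (val y)
            * eps XII (val y))%:C).
Proof.
move=> f KCD; rewrite /KCD /f -HN {KCD f HN N Hcount}.
pose Lr : (X -> R) -> X -> R := Lop XII hI hII.
pose Sr : (X -> R) -> X -> R := Sop XII hI hII.
have bLr : rbounded Lr by exact: (Lop_bounded hII HX Hdisj Hlim HhI_sum).
have bSr : rbounded Sr by exact: (Sop_bounded HX Hdisj Hlim HhI HhI_sum HhII).
have bL0 := cext_bounded bLr; have bS := cext_bounded bSr.
have kL0 x y : kernel_of (cext Lr) x y = (L_kernel XII hI hII (val x) (val y))%:C.
  by rewrite kernel_cext// /Lr Lop_delta.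
split; first by exists (cext Lr).
move=> L bL kL; exists (cext Sr).
(* Any admissible L coincides on [ell2] with the explicit finite rank operator, so the same S serves
   for all of them. *)
have LE := bounded_operator_ext bL bL0 (fun x y => etrans (kL x y) (esym (kL0 x y))).
have SrK := Sop_rightinv HX Hdisj Hlim HhI HhI_sum HhII.
have SrLr := Sop_leftinv HX Hdisj Hlim HhI HhI_sum HhII.
have rightinv u : ell2 u -> one_plus L (cext Sr u) = u.
  move=> lu; rewrite /one_plus LE; last exact: bounded_operator_ell2.
  apply/funext => x; have [lr li] := (ell2P u).1 lu.
  by apply/eqP; rewrite eq_complex; apply/andP; split; apply/eqP; exact: SrK.
have leftinv u : ell2 u -> cext Sr (one_plus L u) = u.
  move=> lu; rewrite /one_plus LE//; have [lr li] := (ell2P u).1 lu.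
  have ReD (z z' : R[i]) : complex.Re (z + z') = complex.Re z + complex.Re z'.
    by case: z; case: z'.
  have ImD (z z' : R[i]) : complex.Im (z + z') = complex.Im z + complex.Im z'.
    by case: z; case: z'.
  have reE : reF (fun x => u x + cext Lr u x) = (fun x => reF u x + Lr (reF u) x).
    by apply/funext => x; rewrite /reF ReD.
  have imE : imF (fun x => u x + cext Lr u x) = (fun x => imF u x + Lr (imF u) x).
    by apply/funext => x; rewrite /imF ImD.
  rewrite {1}/cext reE imE /Sr /Lr SrLr// SrLr//.
  by apply/funext => x; rewrite /reF /imF; case: (u x).
split=> [|x y]; first by split=> // u lu; split; [exact: rightinv|exact: leftinv].
have ly := @ell2_basis R X y.
(* The (x,y) entry of (1 + L) S = 1 expresses that of L S as the identity minus S. *)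
have := congr1 (fun u => u x) (rightinv _ ly).
rewrite /one_plus -/(kernel_of (cext Sr) x y) kernel_cext// /Sr Sop_delta.
rewrite /kernel_of /= => /(canRL (addKr _)) ->.
by rewrite /basis_vector rmorphB rmorph_nat opprB subrK.
Qed.
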